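(* Let $\mathbf P=(P,\leq,{}',0,1)$ be a complemented poset whose complementation is an antitone involution, and let $I$ be an ideal and $F$ a filter of $\mathbf P$. Then (i) $I_0$ is a filter of $\mathbf P$, $I=(I_0)_0$ and hence $I$ is a c-ideal of $\mathbf P$; (ii) $F_0$ is an ideal of $\mathbf P$, $F=(F_0)_0$ and hence $F$ is a c-filter of $\mathbf P$.
   Context: For a poset $(P,\leq)$ and $A\subseteq P$ put $L(A)=\{x\in P\mid x\leq y\text{ for all }y\in A\}$ and $U(A)=\{x\in P\mid y\leq x\text{ for all }y\in A\}$; write $L(a)=L(\{a\})$, $L(a,b)=L(\{a,b\})$, and similarly for $U$. A complemented poset $\mathbf P=(P,\leq,{}',0,1)$ is a bounded poset (bottom $0$, top $1$) with a unary operation ${}'$ (the complementation) such that for every $x\in P$ the join $x\vee x'$ and the meet $x\wedge x'$ exist and $x\vee x'=1$, $x\wedge x'=0$. The operation ${}'$ is antitone if $x\leq y$ implies $y'\leq x'$, and an involution if $x''=x$ for all $x\in P$, where $x''=(x')'$. For $A\subseteq P$ put $A_0=\{x\in P\mid x'\in A\}$. A non-empty subset $I$ of $P$ is an ideal of $\mathbf P$ if $L(x)\subseteq I$ and $U(x,y)\cap I\neq\emptyset$ for all $x,y\in I$. A non-empty subset $F$ of $P$ is a filter of $\mathbf P$ if $U(x)\subseteq F$ and $L(x,y)\cap F\neq\emptyset$ for all $x,y\in F$. An ideal $J$ of $\mathbf P$ is a c-ideal if there exists some filter $G$ of $\mathbf P$ with $G_0=J$. A filter $G$ of $\mathbf P$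 is a c-filter if there exists some ideal $J$ of $\mathbf P$ with $J_0=G$. *)

(* Defs.v *)
From mathcomp Require Import all_boot all_order.
From mathcomp Require Import boolp classical_sets.
Set Implicit Arguments.
Unset Strict Implicit.
Unset Printing Implicit Defensive.
Local Open Scope classical_set_scope.
Local Open Scope order_scope.

(* The cones L(A) and U(A) are the library's [lbound A] and [ubound A], and the
   join (meet) of x and y exists and equals z exactly when
   [supremums [set x; y] z] ([infimums [set x; y] z]). The bounds 0 and 1 are
   [\bot] and [\top]; they are not required to be distinct. *)

Definition complementation {d} {P : tbPOrderType d} (c : P -> P) : Prop :=
  forall x, supremums [set x; c x] \top /\ infimums [set x; c x] \bot.

Definition antitone {d} {P : porderType d} (c : P -> P) : Prop :=
  forall x y, x <= y -> c y <= c x.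

(* A_0 = {x | x' \in A}, not the image {x' | x \in A}; the two agree only when
   the complementation is an involution. *)
Definition compl_preim {d} {P : porderType d} (c : P -> P) (A : set P) : set P :=
  [set x | A (c x)].

(* An ideal need not contain binary joins, which may not exist: it contains some
   common upper bound of any two of its elements, and dually for filters. *)
Definition is_ideal {d} {P : porderType d} (I : set P) : Prop :=
  I !=set0 /\
  forall x y, I x -> I y ->
    lbound [set x] `<=` I /\ ubound [set x; y] `&` I !=set0.

Definition is_filter {d} {P : porderType d} (F : set P) : Prop :=
  F !=set0 /\
  forall x y, F x -> F y ->
    ubound [set x] `<=` F /\ lbound [set x; y] `&` F !=set0.

Definition is_c_ideal {d} {P : porderType d} (c : P -> P) (J : set P) : Prop :=
  is_ideal J /\ exists G : set P, is_filter G /\ compl_preim c G = J.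

Definition is_c_filter {d} {P : porderType d} (c : P -> P) (G : set P) : Prop :=
  is_filter G /\ exists J : set P, is_ideal J /\ compl_preim c J = G.

(* Main.v *)
Require Import Defs.
From mathcomp Require Import all_boot all_order.
From mathcomp Require Import boolp classical_sets.

(** An antitone involution c is an isomorphism from P onto its order dual, so
    it exchanges lower and upper cones and therefore ideals and filters:
    [compl_preim_ideal] and [compl_preim_filter]. Since c is an involution, so
    is A |-> A_0, which is [compl_preimK]; hence I is of the form G_0 for the
    filter G = I_0, and dually F is of the form J_0 for the ideal J = F_0. *)

Lemma compl_preimK (d : Order.disp_t) (P : porderType d) (c : P -> P)
    (A : set P) :
  involutive c -> compl_preim c (compl_preim c A) = A.
Proof. by move=> cK; apply/funext => x; rewrite /compl_preim /mkset cK. Qed.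

Lemma compl_preim_ideal (d : Order.disp_t) (P : porderType d) (c : P -> P)
    (I : set P) :
  antitone c -> involutive c -> is_ideal I -> is_filter (compl_preim c I).
Proof.
move=> c_anti cK [[a Ia] idI]; split; first by exists (c a); rewrite /compl_preim /mkset cK.
move=> x y Icx Icy; have [lI [u [uu Iu]]] := idI _ _ Icx Icy; split.
  move=> z zx; apply: lI => _ ->; exact/c_anti/zx.
(* the complement of an upper bound of c x and c y is a lower bound of x, y *)
exists (c u); split; last by rewrite /compl_preim /mkset cK.
move=> _ [->|->].
  by rewrite -[x]cK; apply/c_anti/uu; left.
by rewrite -[y]cK; apply/c_anti/uu; right.
Qed.

Lemma compl_preim_filter (d : Order.disp_t) (P : porderType d) (c : P -> P)
    (F : set P) :
  antitone c -> involutive c -> is_filter F -> is_ideal (compl_preim c F).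
Proof.
move=> c_anti cK [[a Fa] fiF]; split; first by exists (c a); rewrite /compl_preim /mkset cK.
move=> x y Fcx Fcy; have [uF [l [ll Fl]]] := fiF _ _ Fcx Fcy; split.
  move=> z zx; apply: uF => _ ->; exact/c_anti/zx.
exists (c l); split; last by rewrite /compl_preim /mkset cK.
move=> _ [->|->].
  by rewrite -[x]cK; apply/c_anti/ll; left.
by rewrite -[y]cK; apply/c_anti/ll; right.
Qed.

Theorem corollary10 (d : Order.disp_t) (P : tbPOrderType d) (c : P -> P)
    (c_compl : complementation c) (c_anti : antitone c) (c_invol : involutive c)
    (I F : set P) (idealI : is_ideal I) (filterF : is_filter F) :
  (is_filter (compl_preim c I) /\ I = compl_preim c (compl_preim c I) /\ is_c_ideal c I) /\
  (is_ideal (compl_preim c F) /\ F = compl_preim c (compl_preim c F) /\ is_c_filter c F).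
Proof.
have filI0 := compl_preim_ideal _ _ _ _ c_anti c_invol idealI.
have idF0 := compl_preim_filter _ _ _ _ c_anti c_invol filterF.
split; do 2?split => //; rewrite ?compl_preimK //; split=> //.
  by exists (compl_preim c I); rewrite compl_preimK.
by exists (compl_preim c F); rewrite compl_preimK.
Qed.
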